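(* If $X$ is a Tychonoff space and $\Delta^c_X=(X\times X)\setminus\Delta_X$ is discretely $\sigma$-compact, then $hl(X\times X)=\omega$.
   Context: All spaces are topological spaces assumed to be $T_1$. $\Delta_X=\{(x,x):x\in X\}$ is the diagonal of $X$. A space $Z$ is discretely $\sigma$-compact if the closure (in $Z$) of every discrete subset $D\subset Z$ (i.e. $D$ discrete in its subspace topology) is $\sigma$-compact. $l(Z)$ is the least cardinal $\kappa$ such that every open cover of $Z$ has a subcover of cardinality at most $\kappa$, and $hl(Z)=\sup\{l(Y):Y\subset Z\}$ is the hereditary Lindelöf number. As usual, values of cardinal functions are taken to be infinite, so $hl(X\times X)=\omega$ means that $X\times X$ is hereditarily Lindelöf. *)

(* Defs.v *)
From HB Require Import structures.
From mathcomp Require Import all_boot all_order all_algebra.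
From mathcomp Require Import all_classical all_reals all_analysis.

Set Implicit Arguments.
Unset Strict Implicit.
Unset Printing Implicit Defensive.

Local Open Scope classical_set_scope.
Local Open Scope card_scope.

(* [completely_regular_space] alone does not include T1; it asks for a coarser
   uniformity separating a point from a closed set, which amounts to the usual
   separation by a continuous real function (see [uniform_separatorP]). *)
Definition tychonoff_space (T : topologicalType) : Prop :=
  accessible_space T /\ completely_regular_space T.

(* [set_type D] carries the subspace topology. *)
Definition discrete_subset (Z : topologicalType) (D : set Z) : Prop :=
  forall A : set (set_type D), open A.

Definition sigma_compact (Z : topologicalType) (A : set Z) : Prop :=
  exists2 K : nat -> set Z, (forall n, compact (K n)) & A = \bigcup_n K n.

Definition discretely_sigma_compact (Z : topologicalType) : Prop :=
  forall D : set Z, discrete_subset D -> sigma_compact (closure D).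

(* Cardinals are represented by sets compared with [#<=]. The cover property
   below is upward closed in the cardinal of K, so for infinite K it says that
   l(Z), the least infinite cardinal having it, is at most the cardinal of K. *)
Definition lindelof_number_le (Z : topologicalType) (U : Type) (K : set U) :
    Prop :=
  forall C : set (set Z),
    (forall A, C A -> open A) -> \bigcup_(A in C) A = [set: Z] ->
    exists C' : set (set Z),
      [/\ C' `<=` C, C' #<= K & \bigcup_(A in C') A = [set: Z]].

Definition hereditary_lindelof_number_le (Z : topologicalType) (U : Type)
    (K : set U) : Prop :=
  forall Y : set Z, lindelof_number_le (set_type Y) K.

(* hl(Z) = |K|, hl(Z) being the supremum of the l(Y), that is, their least
   upper bound among the infinite cardinals. *)
Definition hereditary_lindelof_number_eq (Z : topologicalType) (U : Type)
    (K : set U) : Prop :=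
  [/\ infinite_set K,
      hereditary_lindelof_number_le Z K &
      forall (V : Type) (L : set V), infinite_set L ->
        hereditary_lindelof_number_le Z L -> K #<= L].

(* Main.v *)
Require Import Defs.
From mathcomp Require Import all_boot all_order all_algebra.
From mathcomp Require Import all_classical all_reals all_analysis.

(** The proof works with subsets of an ambient space rather than with subspaces,
    and rests on two ideas.

    Selection.  Well-order Y and pick, greedily, the points that lie neither in
    the closure of the points picked before them nor in the open sets of a given
    cover that have been used so far.  The picked set D is discrete, and what is
    not picked is already covered, up to the closure of D.  If the closures of
    discrete subsets of Y are Lindelof in Y and countable sets suffice to reach
    their points, then D is countable and Y is Lindelof
    ([lindelof_of_discrete]).  Both hypotheses hold when the closures have a
    countable network ([lindelof_of_discrete_network]).

    Squares.  If A is compact Hausdorff and A * A minus its diagonal is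
    Lindelof, then countably many disjoint pairs of open sets separate the
    points of A, and finite intersections of them form a countable network
    ([compact_network]).

    Let X be as in the theorem.  If D is discrete in X, then D * D minus the
    diagonal is discrete, and its closure off the diagonal is the square of the
    closure of D minus the diagonal.  So the latter is sigma-compact, the
    closure of D is a countable union of compact sets, and each of these has a
    countable network ([network_discrete_closure]).  By selection every subset
    of X is Lindelof ([lindelof_subset_factor]).

    It follows that compact subsets A of X are first countable, hence that
    A * A is countably tight; selection, now with discrete subsets of A * A
    minus the diagonal, makes this set Lindelof, so that A has a countable
    network ([network_compact_factor]).  Compact sets of pairs sit inside the
    product of their projections, so the sigma-compact closures of discrete sets
    off the diagonal have countable networks, and selection applies once more
    ([lindelof_offdiag]).  The diagonal itself is a copy of X. *)

Set Implicit Arguments.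
Unset Strict Implicit.
Unset Printing Implicit Defensive.

Local Open Scope classical_set_scope.

(** * Lindelof sets *)

Lemma countable_setU (T : Type) (A B : set T) :
  countable A -> countable B -> countable (A `|` B).
Proof.
move=> cA cB; rewrite -bigcup2E; apply: bigcup_countable => //.
by case=> [|[|i]] _ //=; exact: countable0.
Qed.

Definition lindelof_set (T : topologicalType) (Y : set T) : Prop :=
  forall C : set (set T), C `<=` open -> Y `<=` \bigcup_(O in C) O ->
    exists C' : set (set T),
      [/\ C' `<=` C, countable C' & Y `<=` \bigcup_(O in C') O].

Lemma lindelof_index (T : topologicalType) (Y : set T) (I : Type) (D : set I)
    (f : I -> set T) :
  lindelof_set Y -> (forall i, D i -> open (f i)) ->
  Y `<=` \bigcup_(i in D) f i ->
  exists D' : set I,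
    [/\ D' `<=` D, countable D' & Y `<=` \bigcup_(i in D') f i].
Proof.
move=> lY fo Yf.
have [||C [CD cC YC]] := lY (f @` D).
  by move=> _ [i Di <-]; exact: fo.
  by move=> y /Yf[i Di fy]; exists (f i) => //; exists i.
have [g gP] : exists g : set_type C -> I, forall O, D (g O) /\ f (g O) = val O.
  suff /choice[g gP] : forall O : set_type C, exists i, D i /\ f i = val O.
    by exists g.
  by case=> O OC; have /set_mem/CD[i Di fi] := OC; exists i.
exists (range g); split.
- by move=> _ [ O _ <-]; have [] := gP O.
- apply: (sub_countable (card_image_le _ _)).
  by rewrite (eq_countable (card_setT _)).
- move=> y /YC[ O OC Oy].
  exists (g (SigSub (mem_set OC))); first by exists (SigSub (mem_set OC)).
  by have [_ ->] := gP (SigSub (mem_set OC)).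
Qed.

Lemma lindelof_setU (T : topologicalType) (A B : set T) :
  lindelof_set A -> lindelof_set B -> lindelof_set (A `|` B).
Proof.
move=> lA lB C oC; rewrite subUset => -[/lA[//|CA [CAC cA AC]]].
move=> /lB[//|CB [CBC cB BC]]; exists (CA `|` CB); split.
- by rewrite subUset.
- exact: countable_setU.
- move=> x [/AC|/BC] [ O CO Ox]; exists O => //; [by left|by right].
Qed.

Lemma lindelof_bigcup (T : topologicalType) (Y : nat -> set T) :
  (forall n, lindelof_set (Y n)) -> lindelof_set (\bigcup_n Y n).
Proof.
move=> lY C oC YC.
have /choice[f fP] n : exists C' : set (set T),
    [/\ C' `<=` C, countable C' & Y n `<=` \bigcup_(O in C') O].
  by apply: lY => // y Yy; apply: YC; exists n.
exists (\bigcup_n f n); split.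
- by move=> O [n _]; have [+ _ _] := fP n; apply.
- by apply: bigcup_countable => // n _; have [] := fP n.
- move=> y [n _]; have [_ _ /[apply] [[ O fO Oy]]] := fP n.
  by exists O => //; exists n.
Qed.

(** The covering property in a space without a distinguished point; the filter
    used is that of the finite index sets, directed by inclusion. *)
Lemma compact_finite_subcover (T : topologicalType) (K : set T) (I : Type)
    (D : set I) (f : I -> set T) :
  compact K -> (forall i, D i -> open (f i)) -> K `<=` \bigcup_(i in D) f i ->
  exists E : set I, [/\ E `<=` D, finite_set E & K `<=` \bigcup_(i in E) f i].
Proof.
move=> /compact_near_coveringP cK fo Kf.
pose F := filter_from [set E : set I | E `<=` D /\ finite_set E]
  (fun E => [set E' | E `<=` E']).
have FF : Filter F.
  apply: filter_from_filter; first by exists set0; split.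
  move=> E E' [ED fE] [E'D fE']; exists (E `|` E').
    by split; [rewrite subUset|rewrite finite_setU].
  by move=> G; rewrite /= subUset.
have [x /Kf[i Di fxi]|E [ED fE] EK] :=
    cK _ F (fun E => \bigcup_(i in E) f i) FF.
  exists (f i, [set E | E i]); first split => /=.
  - by apply: open_nbhs_nbhs; split=> //; exact: fo.
  - exists [set i]; last by move=> E; apply.
    by split; [move=> _ ->|exact: finite_set1].
  - by move=> [y E] [/= fy Ei]; exists i.
by exists E; split=> //; exact: EK.
Qed.

Lemma compact_lindelof (T : topologicalType) (K : set T) :
  compact K -> lindelof_set K.
Proof.
move=> cK C oC KC.
have [E [EC fE KE]] := compact_finite_subcover cK oC KC.
by exists E; split=> //; exact: finite_set_countable.
Qed.

Lemma lindelof_image (S T : topologicalType) (f : S -> T) (Y : set S) :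
  continuous f -> lindelof_set Y -> lindelof_set (f @` Y).
Proof.
move=> /continuousP cf lY C oC YC.
have [||C' [C'C cC' YC']] := @lindelof_index _ _ _ C (preimage f) lY.
- by move=> O /oC/cf.
- by move=> y Yy; have [|O CO Oy] := YC (f y); [exists y|exists O].
exists C'; split=> // _ [y Yy <-].
by have [ O C'O Oy] := YC' _ Yy; exists O.
Qed.

(** * Discrete sets *)

Definition discrete_in_itself (T : topologicalType) (D : set T) : Prop :=
  D `<=` isolated D.

Lemma discrete_open (T : topologicalType) (D : set T) :
  discrete_in_itself D <->
  forall x, D x -> exists O, [/\ open O, O x & forall y, O y -> D y -> y = x].
Proof.
split=> [dD x Dx|dD x Dx].
  have [_ [V]] := dD x Dx; rewrite nbhsE => -[ O [oO Ox] OV] VD.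
  exists O; split=> // y Oy Dy.
  by have : (V `&` D) y by [split=> //; exact: OV]; rewrite VD.
have [ O [oO Ox OD]] := dD x Dx; split; first exact: mem_set.
exists O; first exact: open_nbhs_nbhs.
by apply/seteqP; split=> [y [Oy Dy]|_ ->] //; exact: OD.
Qed.

Lemma sub_discrete (T : topologicalType) (D E : set T) :
  E `<=` D -> discrete_in_itself D -> discrete_in_itself E.
Proof.
move=> ED /discrete_open dD; apply/discrete_open => x /[dup] Ex /ED/dD.
by move=> [ O [oO Ox OD]]; exists O; split=> // y Oy /ED; exact: OD.
Qed.

(** The isolating neighbourhoods form a cover no member of which can be
    dropped. *)
Lemma lindelof_discrete_countable (T : topologicalType) (D : set T) :
  discrete_in_itself D -> lindelof_set D -> countable D.
Proof.
move=> /discrete_open dD lD.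
have /choice[ O OP] x : exists O, D x ->
    [/\ open O, O x & forall y, O y -> D y -> y = x].
  have [/dD[ O]|] := pselect (D x); first by exists O.
  by exists setT.
have [x /OP[] //||D' [D'D cD' DD']] := @lindelof_index _ _ _ D O lD.
  by move=> x Dx; exists x => //; have [] := OP _ Dx.
apply: sub_countable cD'; apply: subset_card_le => x Dx.
have [y D'y Oyx] := DD' _ Dx.
by have [_ _ /(_ x Oyx Dx) ->] := OP _ (D'D _ D'y).
Qed.

(** * Countable networks *)

(** Members of the network are only constrained on their trace on A, so that the
    same network serves every subset of A. *)
Definition has_countable_network (T : topologicalType) (A : set T) : Prop :=
  exists2 N : set (set T), countable N &
    forall x O, A x -> open O -> O x ->
      exists M, [/\ N M, M x & M `&` A `<=` O].

Lemma sub_network (T : topologicalType) (A B : set T) :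
  A `<=` B -> has_countable_network B -> has_countable_network A.
Proof.
move=> AB [N cN NP]; exists N => // x O /AB Bx oO Ox.
have [M [NM Mx MO]] := NP x O Bx oO Ox; exists M; split=> //.
by move=> y [My /AB By]; exact: MO.
Qed.

Lemma network_lindelof (T : topologicalType) (A : set T) :
  has_countable_network A -> lindelof_set A.
Proof.
move=> [N cN NP] C oC AC.
have /choice[f fP] (M : set T) : exists O,
    (exists2 O', C O' & M `&` A `<=` O') -> C O /\ M `&` A `<=` O.
  have [[ O CO MO]|nM] := pselect (exists2 O', C O' & M `&` A `<=` O').
    by exists O.
  by exists setT => /nM.
(* One member of the cover is kept for each M of the network that fits in
   some member; every point of A lies in such an M. *)
exists (f @` [set M | N M /\ exists2 O, C O & M `&` A `<=` O]); split.
- by move=> _ [M [_ /fP[CM _]] <-].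
- apply: (sub_countable (card_image_le _ _)); apply: sub_countable cN.
  by apply: subset_card_le => M [].
- move=> x Ax; have [ O CO Ox] := AC x Ax.
  have [M [NM Mx MO]] := NP x O Ax (oC _ CO) Ox.
  have MC : exists2 O, C O & M `&` A `<=` O by exists O.
  have [_ Mf] := fP M MC.
  by exists (f M); [exists M|exact: Mf].
Qed.

Lemma network_bigcup (T : topologicalType) (A : nat -> set T) :
  (forall n, has_countable_network (A n)) ->
  has_countable_network (\bigcup_n A n).
Proof.
move=> nA.
have /choice[N NP] n : exists N : set (set T), countable N /\
    forall x O, A n x -> open O -> O x ->
      exists M, [/\ N M, M x & M `&` A n `<=` O].
  by have [N cN NP] := nA n; exists N.
exists (\bigcup_n [set M `&` A n | M in N n]).
  apply: bigcup_countable => // n _.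
  by apply: (sub_countable (card_image_le _ _)); have [] := NP n.
move=> x O [n _ Anx] oO Ox; have [_ /(_ x O Anx oO Ox)[M [NM Mx MO]]] := NP n.
exists (M `&` A n); split=> //; first by exists n => //; exists M.
by move=> y [/MO].
Qed.

Lemma network_setX (S T : topologicalType) (A : set S) (B : set T) :
  has_countable_network A -> has_countable_network B ->
  has_countable_network (A `*` B).
Proof.
move=> [N cN NP] [N' cN' N'P].
exists [set M.1 `*` M.2 | M in N `*` N'].
  by apply: (sub_countable (card_image_le _ _)); exact: countableX.
move=> [x y] O [/= Ax By] oO Oxy.
have : nbhs (x, y) O by exact: open_nbhs_nbhs.
case=> -[U V] /= [+ +] UVO; rewrite !nbhsE.
move=> [U' [oU U'x] UU] [V' [oV V'y] VV].
have [M [NM Mx MU]] := NP x U' Ax oU U'x.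
have [M' [NM' My MV]] := N'P y V' By oV V'y.
exists (M `*` M'); split=> //; first by exists (M, M').
move=> [a b] [[/= Ma Mb] [/= Aa Bb]]; apply: UVO => /=; split=> /=.
  exact/UU/MU.
exact/VV/MV.
Qed.

(** * Separating pairs in compact Hausdorff sets *)

Lemma nbhs_setX (S T : topologicalType) (x : S) (y : T) (U : set S)
    (V : set T) :
  nbhs x U -> nbhs y V -> nbhs (x, y) (U `*` V).
Proof. by move=> xU yV; exists (U, V). Qed.

Lemma open_setX (S T : topologicalType) (U : set S) (V : set T) :
  open U -> open V -> open (U `*` V).
Proof.
move=> oU oV; rewrite openE => -[x y] [/= Ux Vy].
by apply: nbhs_setX; apply: open_nbhs_nbhs.
Qed.

Definition disjoint_open_pairs (T : topologicalType) : set (set T * set T) :=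
  [set p | [/\ open p.1, open p.2 & p.1 `&` p.2 `<=` set0]].

(** By compactness of A minus O, finitely many of the second components cover
    it, and the matching first components meet inside O.  This one fact yields
    both countable networks and countable local bases. *)
Lemma compact_separating_nbhs (T : topologicalType) (A : set T)
    (J : set (set T * set T)) (a : T) (O : set T) :
  compact A -> J `<=` @disjoint_open_pairs T ->
  (forall b, A b -> b <> a -> exists p, [/\ J p, p.1 a & p.2 b]) ->
  open O -> O a ->
  exists F : set (set T * set T), [/\ F `<=` J, finite_set F,
    forall p, F p -> p.1 a & (\bigcap_(p in F) p.1) `&` A `<=` O].
Proof.
move=> cA Jd Ja oO Oa.
have cAO : compact (A `\` O).
  by rewrite setDE; apply: compact_closedI => //; exact: open_closedC.
have [p [Jp _]|b [Ab Ob]|F [FJ fF FA]] :=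
    @compact_finite_subcover _ _ _ (J `&` [set p | p.1 a]) snd cAO.
- by have [] := Jd _ Jp.
- have [|p [Jp pa pb]] := Ja b Ab; first by move=> ba; apply: Ob; rewrite ba.
  by exists p.
exists F; split=> //; [by move=> p /FJ[] | by move=> p /FJ[] |].
move=> x [Fx Ax]; apply: contrapT => Ox.
have [//|p Fp px] := FA x; have [/Jd[_ _ pd] _] := FJ _ Fp.
by apply: (pd x); split=> //; exact: Fx.
Qed.

Lemma network_of_separating_pairs (T : topologicalType) (A : set T)
    (J : set (set T * set T)) :
  compact A -> countable J -> J `<=` @disjoint_open_pairs T ->
  (forall a b, A a -> A b -> a <> b -> exists p, [/\ J p, p.1 a & p.2 b]) ->
  has_countable_network A.
Proof.
move=> cA cJ Jd JA.
exists [set \bigcap_(p in F) p.1 | F in [set F | F `<=` J /\ finite_set F]].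
  by apply: (sub_countable (card_image_le _ _)); exact: countable_finite_subset.
move=> a O Aa oO Oa.
have [b Ab ba|F [FJ fF Fa FO]] := compact_separating_nbhs cA Jd _ oO Oa.
  by apply: JA => //; exact: nesym.
by exists (\bigcap_(p in F) p.1); split=> //; exists F.
Qed.

Lemma hausdorff_separation (T : topologicalType) (a b : T) :
  hausdorff_space T -> a <> b ->
  exists p, [/\ disjoint_open_pairs p, p.1 a & p.2 b].
Proof.
rewrite open_hausdorff => hT /eqP/hT[p [/set_mem pa /set_mem pb]].
move=> [op1 op2 /eqP p0].
by exists p; split=> //; split=> //; rewrite p0.
Qed.

Lemma compact_network (T : topologicalType) (A : set T) :
  hausdorff_space T -> compact A ->
  lindelof_set ((A `*` A) `\` @diagonal T) -> has_countable_network A.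
Proof.
move=> hT cA lA.
have [|[a b] [_ ab]|J [JD cJ JA]] :=
    @lindelof_index _ _ _ (@disjoint_open_pairs T) (fun p => p.1 `*` p.2) lA.
- by move=> p [op1 op2 _]; exact: open_setX.
- by have [p [pd pa pb]] := hausdorff_separation hT ab; exists p.
apply: (network_of_separating_pairs cA cJ JD) => a b Aa Ab ab.
by have [|p Jp [pa pb]] := JA (a, b); [split|exists p].
Qed.

Lemma compact_countable_base (T : topologicalType) (A : set T) (a : T) :
  hausdorff_space T -> compact A -> lindelof_set (A `\ a) ->
  exists G : set (set T), [/\ countable G, forall M, G M -> nbhs a M &
    forall O, open O -> O a -> exists2 M, G M & M `&` A `<=` O].
Proof.
move=> hT cA lA.
have [|b [_ /nesym ab]|J [JD cJ JA]] := @lindelof_index _ _ _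
    (@disjoint_open_pairs T `&` [set p | p.1 a]) snd lA.
- by move=> p [[]].
- by have [p [pd pa pb]] := hausdorff_separation hT ab; exists p.
exists [set \bigcap_(p in F) p.1 | F in [set F | F `<=` J /\ finite_set F]].
split.
- by apply: (sub_countable (card_image_le _ _)); exact: countable_finite_subset.
- move=> _ [F [FJ fF] <-]; have [s Fs] := finite_fsetP.1 fF.
  rewrite Fs; apply: filter_bigI => p ps.
  have [[op _ _] pa] : (@disjoint_open_pairs T `&` [set p | p.1 a]) p.
    by apply/JD/FJ; rewrite Fs.
  exact: open_nbhs_nbhs.
- move=> O oO Oa.
  have [||F [FJ fF Fa FO]] := @compact_separating_nbhs _ A J a O cA _ _ oO Oa.
  + by move=> p /JD[].
  + move=> b Ab ba; have [|p Jp pb] := JA b; first by split.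
    by exists p; split=> //; have [] := JD _ Jp.
  + by exists (\bigcap_(p in F) p.1) => //; exists F.
Qed.

Lemma hausdorff_setX (S T : topologicalType) :
  hausdorff_space S -> hausdorff_space T -> hausdorff_space (S * T)%type.
Proof.
move=> hS hT [a b] [c d] cl; congr pair.
- apply: hS => U V aU cV.
  have [||[x y] [[/= Ux _] [/= Vx _]]] := cl (U `*` setT) (V `*` setT).
  + by apply: nbhs_setX => //; exact: filterT.
  + by apply: nbhs_setX => //; exact: filterT.
  by exists x.
- apply: hT => U V bU dV.
  have [||[x y] [[/= _ Uy] [/= _ Vy]]] := cl (setT `*` U) (setT `*` V).
  + by apply: nbhs_setX => //; exact: filterT.
  + by apply: nbhs_setX => //; exact: filterT.
  by exists y.
Qed.

(** * Well-ordered selection *)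

Lemma well_order_strict (T : eqType) : exists lt : T -> T -> Prop,
  [/\ well_founded lt, (forall x y z, lt x y -> lt y z -> lt x z) &
      forall x y, [\/ lt x y, x = y | lt y x]].
Proof.
have [R wR] := wochoice.well_ordering_principle T.
have minR (A : set T) : A !=set0 -> exists2 m, A m & forall x, A x -> R m x.
  move=> [a Aa]; have [|m [[mA mle] _]] := wR (mem A).
    by exists a; exact: mem_set.
  exists m; first exact: set_mem.
  by move=> x Ax; apply: mle; exact: mem_set.
have reflR x : R x x by have [|m -> mR] := minR [set x]; [exists x|exact: mR].
have totR x y : R x y \/ R y x.
  have [|m [] -> mR] := minR [set x; y]; first by exists x; left.
    by left; apply: mR; right.
  by right; apply: mR; left.
have antiR x y : R x y -> R y x -> x = y.
  move=> xy yx; have [|m [_ mu]] := wR (mem [set x; y]).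
    by exists x; apply: mem_set; left.
  have mx : m = x; last rewrite -mx; apply: mu; split.
  - by apply: mem_set; left.
  - by move=> z /set_mem[] ->.
  - by apply: mem_set; right.
  - by move=> z /set_mem[] ->.
have transR x y z : R x y -> R y z -> R x z.
  move=> xy yz; have [|m [[]|] -> mR] := minR [set x; y; z].
  - by exists x; left; left.
  - by apply: mR; right.
  - by have -> : x = y by apply: antiR => //; apply: mR; left; left.
  - by have <- : y = z by apply: antiR => //; apply: mR; left; right.
exists (fun x y => ~ R y x); split.
- move=> x; apply: contrapT => xacc.
  have [|m macc mR] := minR [set x | ~ Acc (fun x y => ~ R y x) x].
    by exists x.
  by apply: macc; constructor=> y ym; apply: contrapT => /mR.
- move=> x y z yx zy zx; have [xy|//] := totR x y.
  exact/zy/(transR z x y).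
- move=> x y; have [xy|yx] := pselect (R x y); last by constructor 3.
  have [yx|yx] := pselect (R y x); last by constructor 1.
  by constructor 2; exact: antiR.
Qed.

(** Transfinite recursion for greedy choices: whether y is selected depends on
    the set of the points selected before y. *)
Lemma transfinite_selection (T : Type) (lt : T -> T -> Prop)
    (P : set T -> T -> Prop) : well_founded lt ->
  exists D : set T, forall y, D y <-> P [set x | D x /\ lt x y] y.
Proof.
move=> wf; pose F y (rec : forall x, lt x y -> Prop) : Prop :=
  P [set x | exists xy : lt x y, rec x xy] y.
exists (Fix wf (fun _ => Prop) F) => y.
rewrite {1}Fix_eq /F; last first.
  move=> x f g fg; congr (P _ x); apply/seteqP.
  by split=> z [zx]; [rewrite fg|rewrite -fg] => ?; exists zx.
suff -> : [set x | exists _ : lt x y, Fix wf (fun _ => Prop) F x] =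
          [set x | Fix wf (fun _ => Prop) F x /\ lt x y] by [].
by apply/seteqP; split=> x [].
Qed.

(** For a discrete E, let c E be a countable part of the cover C that covers the
    closure of E in Y.  Select y when it is outside the closure of the points
    selected before y and outside every V d, where d < y is selected and V d is
    a member of C around d together with c of the selected points up to d.  The
    selected set D is discrete.
    If it were uncountable, its elements with countably many selected
    predecessors would form an initial segment D' of type omega_1.  A countable
    part of D' is bounded in D', so by tightness the sets V d with d in D' cover
    the closure of D', hence countably many of them do; but a point of D' above
    these countably many indices was selected outside all of them. *)
Lemma lindelof_of_discrete (T : topologicalType) (Y : set T) :
  (forall D, D `<=` Y -> discrete_in_itself D ->
    lindelof_set (closure D `&` Y)) ->
  (forall D p, D `<=` Y -> discrete_in_itself D -> closure D p -> Y p ->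
    exists E, [/\ E `<=` D, countable E & closure E p]) ->
  lindelof_set Y.
Proof.
move=> lY tY C oC YC.
have [lt [wf lt_trans lt_total]] := well_order_strict T.
have /choice[c cP] (E : set T) : exists c : set (set T), E `<=` Y ->
    discrete_in_itself E -> [/\ c `<=` C, countable c &
      closure E `&` Y `<=` \bigcup_(O in c) O].
  have [[EY dE]|nE] := pselect (E `<=` Y /\ discrete_in_itself E); last first.
    by exists set0 => EY dE; exfalso; exact: nE.
  have [|c [cC cc Ec]] := lY _ EY dE C oC; last by exists c.
  by move=> y [_ /YC].
have /choice[u uP] (y : T) : exists O, Y y -> C O /\ O y.
  by have [/YC[ O CO Oy]|nY] := pselect (Y y); [exists O|exists setT].
pose upto (E : set T) d := [set x | E x /\ (lt x d \/ x = d)].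
(* The neighbourhood u d puts d itself in W E d even before the selected set is
   known to be discrete, that is, before c is known to cover anything. *)
pose W E d := u d `|` \bigcup_(O in c (upto E d)) O.
have [D DP] := @transfinite_selection T lt (fun E y =>
  [/\ Y y, ~ closure E y & forall d, E d -> ~ W E d y]) wf.
have DY : D `<=` Y by move=> y /DP[].
pose V d := W D d.
(* This lets the selection condition, which sees only the points below y, be
   read with D itself. *)
have upto_below d y : lt d y -> upto [set x | D x /\ lt x y] d = upto D d.
  move=> dy; apply/seteqP; split=> x [].
    by move=> [Dx _] xd; split.
  by move=> Dx xd; do 2 split=> //; case: xd => [/lt_trans|->]; [exact|].
have DV d y : D d -> D y -> lt d y -> ~ V d y.
  move=> Dd /DP[_ _ Dy] dy; rewrite /V /W -(upto_below d y dy).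
  by apply: Dy; split.
have dD : discrete_in_itself D.
  apply/discrete_open => y Dy; have [Yy ycl _] := (DP y).1 Dy.
  have [Cu uy] := uP y Yy.
  exists (u y `&` ~` closure [set x | D x /\ lt x y]); split=> //.
    by apply: openI; [exact: oC|exact/closed_openC/closed_closure].
  move=> x [ux xcl] Dx; have [xy|//|yx] := lt_total x y.
    by exfalso; apply: xcl; apply: subset_closure; split.
  by exfalso; apply: (DV y x) => //; left.
have uptoD d : upto D d `<=` D by move=> x [].
have cV d : [/\ c (upto D d) `<=` C, countable (c (upto D d)) &
    closure (upto D d) `&` Y `<=` V d].
  have [|| cC cc clc] := cP (upto D d).
  - exact: subset_trans (uptoD d) DY.
  - exact: sub_discrete (uptoD d) dD.
  by split=> // x /clc; right.
have oV d : D d -> open (V d).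
  move=> /DY /uP[Cu _]; apply: openU; first exact: oC.
  by have [cC _ _] := cV d; apply: bigcup_open => O /cC; exact: oC.
have cD : countable D.
  apply: contrapT => ncD.
  (* D' is the initial segment of type omega_1: all its proper initial segments
     are countable, and D' is not. *)
  pose D' := D `&` [set d | countable (upto D d)].
  have D'D : D' `<=` D by move=> d [].
  have D'Y : D' `<=` Y by exact: subset_trans D'D DY.
  have ncD' : ~ countable D'.
    move=> cD'; apply: ncD.
    suff : D `<=` D'.
      by move=> DD'; apply: sub_countable cD'; exact: subset_card_le.
    elim/(well_founded_ind wf) => d IH Dd; split=> //=.
    apply: (@sub_countable _ _ _ (D' `|` [set d])); last first.
      exact: countable_setU cD' (countable1 d).
    by apply: subset_card_le => x [Dx [xd|->]]; [left; exact: IH|right].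
  have above E : E `<=` D' -> countable E ->
      exists2 d, D' d & forall x, E x -> lt x d.
    move=> ED' cE; apply: contrapT => nE; apply: ncD'.
    apply: (@sub_countable _ _ _ (\bigcup_(e in E) upto D e)); last first.
      by apply: bigcup_countable => // e /ED'[].
    apply: subset_card_le => d D'd; apply: contrapT => dE; apply: nE.
    exists d => // x Ex; have [//|xd|dx] := lt_total x d.
      by exfalso; apply: dE; exists x => //; split; [exact: D'D|right].
    by exfalso; apply: dE; exists x => //; split; [exact: D'D|left].
  have dD' := sub_discrete D'D dD.
  have [d /D'D/oV //||E [ED' cE DE]] :=
      @lindelof_index _ _ _ D' V (lY _ D'Y dD').
    move=> p [D'p Yp]; have [E [ED' cE Ep]] := tY D' p D'Y dD' D'p Yp.
    have [d D'd Ed] := above E ED' cE; exists d => //.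
    have [_ _] := cV d; apply; split=> //; apply: closureS Ep => x Ex.
    by split; [exact/D'D/ED'|left; exact: Ed].
  have [d D'd Ed] := above E ED' cE.
  have [|e Ee] := DE d; first by split; [exact: subset_closure|exact: D'Y].
  by apply: DV (Ed _ Ee) => //; apply: D'D => //; exact: ED'.
have [cDC ccD clD] := cP D DY dD.
exists (c D `|` \bigcup_(d in D) (c (upto D d) `|` [set u d])); split.
- rewrite subUset; split=> // O [d Dd [|->]].
    by have [+ _ _] := cV d; apply.
  by have [] := uP d (DY _ Dd).
- apply: countable_setU => //; apply: bigcup_countable => // d Dd.
  by apply: countable_setU; [have [] := cV d|exact: countable1].
- move=> y Yy.
  have [Dy|[d Dd Vdy]] : closure D y \/ exists2 d, D d & V d y.
    have [Dy|nDy] := pselect (D y); first by left; exact: subset_closure.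
    apply: contrapT => /not_orP[ncl nV]; apply/nDy/DP; split=> //.
      by apply: contra_not ncl; apply: closureS => x [].
    move=> d [Dd dy]; rewrite /W upto_below // => Vdy.
    by apply: nV; exists d.
  + by have [ O cO Oy] := clD y (conj Dy Yy); exists O => //; left.
  + case: Vdy => [udy|[ O cO Oy]].
      by exists (u d) => //; right; exists d => //; right.
    by exists O => //; right; exists d => //; left.
Qed.

(** Sets with a countable network are hereditarily Lindelof, so discrete sets
    are countable here and tightness along them is immediate. *)
Lemma lindelof_of_discrete_network (T : topologicalType) (Y : set T) :
  (forall D, D `<=` Y -> discrete_in_itself D ->
    has_countable_network (closure D `&` Y)) ->
  lindelof_set Y.
Proof.
move=> nY; apply: lindelof_of_discrete => [D DY dD|D p DY dD Dp Yp].
  exact/network_lindelof/nY.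
exists D; split=> //; apply: lindelof_discrete_countable => //.
apply: network_lindelof; apply: sub_network (nY D DY dD) => x Dx.
by split; [exact: subset_closure|exact: DY].
Qed.

(** * From the hypothesis on the subspace to sets of pairs *)

(** A uniformity coarser than the topology separates x from the closed set {y},
    and half of the separating entourage gives disjoint neighbourhoods. *)
Lemma tychonoff_hausdorff (T : topologicalType) :
  tychonoff_space T -> hausdorff_space T.
Proof.
move=> [T1 crT] x y xy; apply: contrapT => nxy.
have nyx : ~ [set y] x by move=> /= yx; exact: nxy.
have cy : closed [set y] by exact: accessible_closed_set1.
have [uT [E [entE xyE nbhsT]]] := crT x [set y] cy nyx.
pose UT := Uniform.Pack uT.
have nx : nbhs x (xsection (split_ent (E : set (UT * UT))) x).
  exact/nbhsT/nbhs_entourage/entourage_split_ent.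
have ny : nbhs y (xsection ((split_ent (E : set (UT * UT)))^-1)%relation y).
  exact/nbhsT/nbhs_entourage/entourage_inv/entourage_split_ent.
have [z [/xsectionP xz /xsectionP zy]] := xy _ _ nx ny.
have : ([set x] `*` [set y] `&` E) (x, y).
  by split=> //; exact: (entourage_split (z : UT) entE).
by rewrite xyE.
Qed.

Lemma discretely_sigma_compact_sub (T : topologicalType) (Z : set T) :
  discretely_sigma_compact (set_type Z) ->
  forall D, D `<=` Z -> discrete_in_itself D -> sigma_compact (closure D `&` Z).
Proof.
move=> sZ D DZ /discrete_open dD.
pose D0 : set (set_type Z) := set_val @^-1` D.
have dD0 : discrete_subset D0.
  move=> A.
  have /choice[f fP] (x : T) : exists O, D x ->
      [/\ open O, O x & forall y, O y -> D y -> y = x].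
    have [/dD[ O]|] := pselect (D x); first by exists O.
    by exists setT.
  pose D1 := [set x | D x /\ exists2 a : set_type D0, A a & val (val a) = x].
  pose B := \bigcup_(x in D1) f x.
  exists (set_val @^-1` B).
    exists B => //; apply: bigcup_open => x [Dx _].
    by have [] := fP x Dx.
  apply/seteqP; split=> [a [x [Dx [a' Aa' a'x]] fxa]|a Aa].
    have [_ _ /(_ _ fxa)] := fP x Dx.
    have Da : D (val (val a)) by have /set_mem := valP a.
    by move=> /(_ Da); rewrite -a'x => /val_inj/val_inj ->.
  have Da : D (val (val a)) by have /set_mem := valP a.
  exists (val (val a)); first by split=> //; exists a.
  by have [] := fP _ Da.
have [K cK clK] := sZ D0 dD0.
exists (fun n => set_val @` K n).
  move=> n; apply: continuous_compact => //.
  by apply: continuous_subspaceT; exact: initial_continuous.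
rewrite -image_bigcup -clK; apply/seteqP; split=> [x [clx Zx]|_ [z clz <-]].
  exists (SigSub (mem_set Zx)) => // B [_ [[ O oO <-] /= Ox] OB].
  have [y [Dy Oy]] := clx O (open_nbhs_nbhs (conj oO Ox)).
  by exists (SigSub (mem_set (DZ y Dy))); split=> //; exact: OB.
split; last by have /set_mem := valP z.
move=> B /(@initial_continuous _ _ (set_val : Z -> T) z) zB.
have [y [Dy By]] := clz _ zB.
by exists (val y).
Qed.

Lemma lindelof_number_le_nat (T : topologicalType) (Y : set T) :
  lindelof_set Y -> lindelof_number_le (set_type Y) [set: nat].
Proof.
move=> lY C oC CY.
have /choice[f fP] (A : set (set_type Y)) : exists O : set T,
    C A -> open O /\ set_val @^-1` O = A.
  have [/oC[ O oO OA]|nCA] := pselect (C A); first by exists O.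
  by exists setT.
have [A /fP[]//|y Yy|C' [C'C cC' YC']] := @lindelof_index _ _ _ C f lY.
  have : [set: set_type Y] (SigSub (mem_set Yy)) by [].
  rewrite -CY => -[A CA Ay]; exists A => //.
  by have [_ AE] := fP A CA; move: Ay; rewrite -{1}AE.
exists C'; split=> //; apply/seteqP; split=> // y _.
have [|A C'A fAy] := YC' (val y); first by have /set_mem := valP y.
exists A => //; have [_ AE] := fP A (C'C _ C'A).
by rewrite -AE.
Qed.
Section OffDiagonal.
Variable X : topologicalType.
Hypothesis hX : hausdorff_space X.
Hypothesis sigmaX : forall D : set (X * X), D `<=` ~` @diagonal X ->
  discrete_in_itself D -> sigma_compact (closure D `&` ~` @diagonal X).

Lemma discrete_offdiag_square (D : set X) :
  discrete_in_itself D -> discrete_in_itself (D `*` D `\` @diagonal X).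
Proof.
move=> /discrete_open dD; apply/discrete_open => -[x y] [[/= Dx Dy] _].
have [U [oU Ux UD]] := dD x Dx; have [V [oV Vy VD]] := dD y Dy.
exists (U `*` V); split=> //; first exact: open_setX.
by move=> [a b] [/= Ua Vb] [[/= Da Db] _]; congr pair; [exact: UD|exact: VD].
Qed.

(** Distinct points have disjoint neighbourhoods, so a point off the diagonal
    can be approached by pairs of distinct elements of D. *)
Lemma closure_offdiag_square (D : set X) :
  closure (D `*` D `\` @diagonal X) `&` ~` @diagonal X =
  closure D `*` closure D `\` @diagonal X.
Proof.
apply/seteqP; split=> -[x y] [].
  move=> clxy xy; split=> //; split=> /= B nB.
    have [] := clxy (B `*` setT); first exact: nbhs_setX nB filterT.
    by move=> [a b] [[[/= Da _] _] [/= Ba _]]; exists a.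
  have [] := clxy (setT `*` B); first by apply: nbhs_setX => //; exact: filterT.
  by move=> [a b] [[[/= _ Db] _] [/= _ Bb]]; exists b.
move=> [/= clx cly] xy; split=> // B [[U V] /= [xU yV] UVB].
have [[U' V'] [[oU oV UV0] U'x V'y]] := hausdorff_separation hX xy.
have [a [Da [Ua U'a]]] := clx _ (filterI xU (open_nbhs_nbhs (conj oU U'x))).
have [b [Db [Vb V'b]]] := cly _ (filterI yV (open_nbhs_nbhs (conj oV V'y))).
exists (a, b); split; last exact: UVB.
split=> // ab; apply: (UV0 a); split=> //=.
by have -> : a = b by exact: ab.
Qed.

(** With a partner y in the closure, x is the first coordinate of a point (x, y)
    of the sigma-compact set closure D * closure D minus the diagonal. *)
Lemma network_discrete_closure (D : set X) :
  discrete_in_itself D -> has_countable_network (closure D).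
Proof.
move=> dD.
have [|K cK] := sigmaX _ (discrete_offdiag_square dD); first by move=> p [].
rewrite closure_offdiag_square => KE.
have [[a [b [Da Db ab]]]|one] :=
    pselect (exists a b, [/\ closure D a, closure D b & a <> b]); last first.
  (* The closure of D has at most one point, so any open set meeting it contains
     it. *)
  exists [set setT]; first exact: countable1.
  move=> x O Dx oO Ox; exists setT; split=> // y [_ Dy].
  have [->//|xy] := pselect (y = x); exfalso; apply: one.
  by exists y, x.
have KD n : K n `<=` closure D `*` closure D `\` @diagonal X.
  by rewrite KE => p Kp; exists n.
pose A n := fst @` K n.
have AD n : A n `<=` closure D by move=> _ [p /KD[[pD _] _] <-].
have cA n : compact (A n).
  apply: continuous_compact => //; apply: continuous_subspaceT.
  by move=> p; exact: cvg_fst.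
apply: (@sub_network _ _ (\bigcup_n A n)).
  move=> x Dx; have [y Dy xy] : exists2 y, closure D y & x <> y.
    have [xa|xa] := pselect (x = a); last by exists a.
    by exists b => //; rewrite xa.
  have : (closure D `*` closure D `\` @diagonal X) (x, y) by [].
  by rewrite KE => -[n _ Kxy]; exists n => //; exists (x, y).
apply: network_bigcup => n; apply: compact_network => //.
have -> : A n `*` A n `\` @diagonal X = \bigcup_m (K m `&` A n `*` A n).
  apply/seteqP; split=> [p [Ap dp]|p [m _ [Kp Ap]]]; last first.
    by split=> //; have [] := KD m p Kp.
  have : (closure D `*` closure D `\` @diagonal X) p.
    by case: Ap => /AD A1 /AD A2; split.
  by rewrite KE => -[m _ Kp]; exists m.
apply: lindelof_bigcup => m; apply: compact_lindelof.
apply: compact_closedI => //.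
by apply: compact_closed; [exact: hausdorff_setX|exact: compact_setX].
Qed.

Lemma lindelof_subset_factor (Y : set X) : lindelof_set Y.
Proof.
apply: lindelof_of_discrete_network => D DY dD.
by apply: sub_network (network_discrete_closure dD) => x [].
Qed.

(** Compact subsets of X are first countable because their points are relatively
    G-delta; countable local bases at the two coordinates index the points of E
    to be kept. *)
Lemma square_tight (A : set X) (E : set (X * X)) (p : X * X) :
  compact A -> E `<=` A `*` A -> closure E p ->
  exists C, [/\ C `<=` E, countable C & closure C p].
Proof.
case: p => a b cA EA clE.
have [G [cG nG GO]] :=
  compact_countable_base (a := a) hX cA (@lindelof_subset_factor _).
have [H [cH nH HO]] :=
  compact_countable_base (a := b) hX cA (@lindelof_subset_factor _).
have /choice[f fP] (M : set X * set X) : exists e, (G `*` H) M ->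
    E e /\ (M.1 `*` M.2) e.
  have [[GM HM]|nM] := pselect ((G `*` H) M); last by exists (a, b).
  have [e [Ee Me]] := clE _ (nbhs_setX (nG _ GM) (nH _ HM)).
  by exists e.
exists (f @` (G `*` H)); split.
- by move=> _ [M GHM <-]; have [] := fP M GHM.
- by apply: (sub_countable (card_image_le _ _)); exact: countableX.
- move=> B [[U V] /= [+ +] UVB]; rewrite !nbhsE.
  move=> [U' [oU' U'a] U'U] [V' [oV' V'b] V'V].
  have [M GM MU] := GO U' oU' U'a; have [N HN NV] := HO V' oV' V'b.
  have [//|Ee [M1 M2]] := fP (M, N); have [A1 A2] := EA _ Ee.
  exists (f (M, N)); split; first by exists (M, N).
  by apply: UVB; split=> /=; [exact/U'U/MU|exact/V'V/NV].
Qed.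

Lemma network_compact_factor (A : set X) :
  compact A -> has_countable_network A.
Proof.
move=> cA; apply: compact_network => //.
have clA : closed (A `*` A).
  by apply: compact_closed; [exact: hausdorff_setX|exact: compact_setX].
apply: lindelof_of_discrete => [D DA dD|D p DA dD Dp _]; last first.
  by apply: (square_tight cA) Dp => q /DA[].
have [|K cK KE] := sigmaX _ dD; first by move=> q /DA[].
rewrite setDE [A `*` A `&` _]setIC setIA KE setI_bigcupl.
apply: lindelof_bigcup => m; apply: compact_lindelof; exact: compact_closedI.
Qed.

Lemma lindelof_offdiag (Y : set (X * X)) :
  Y `<=` ~` @diagonal X -> lindelof_set Y.
Proof.
move=> Yd; apply: lindelof_of_discrete_network => D DY dD.
have [|K cK KE] := sigmaX _ dD; first exact: subset_trans DY Yd.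
apply: (@sub_network _ _ (\bigcup_n K n)).
  by rewrite -KE => p [Dp /Yd].
apply: network_bigcup => n.
have KX : K n `<=` (fst @` K n) `*` (snd @` K n).
  by move=> p Kp; split; exists p.
apply: (sub_network KX); apply: network_setX; apply: network_compact_factor.
all: apply: continuous_compact => //; apply: continuous_subspaceT => p.
- exact: cvg_fst.
- exact: cvg_snd.
Qed.

Lemma lindelof_subset_square (Y : set (X * X)) : lindelof_set Y.
Proof.
have -> : Y = (Y `&` @diagonal X) `|` (Y `\` @diagonal X) by rewrite setUIDK.
apply: lindelof_setU; last by apply: lindelof_offdiag => p [].
have -> : Y `&` @diagonal X = (fun x => (x, x)) @` [set x | Y (x, x)].
  apply/seteqP; split=> [[x y] [Yp xy]|_ [x Yx <-]] //.
  have {}xy : x = y by []; rewrite -{}xy in Yp *.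
  by exists x.
apply: lindelof_image; last exact: lindelof_subset_factor.
by move=> x; apply: cvg_pair.
Qed.

End OffDiagonal.

Theorem proposition3p1 (X : topologicalType) :
  tychonoff_space X ->
  discretely_sigma_compact (set_type (~` (@diagonal X))) ->
  hereditary_lindelof_number_eq (X * X)%type [set: nat].
Proof.
move=> /tychonoff_hausdorff hX /discretely_sigma_compact_sub sX; split.
- exact: infinite_nat.
- by move=> Y; apply: lindelof_number_le_nat; exact: lindelof_subset_square.
- by move=> V L /infiniteP.
Qed.
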